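(* Let $\{(X_t,c_t):t\in T\}$ be a family of pairwise disjoint fuzzy closure spaces. The sum $(X,c)=\big(\bigcup_{t\in T}X_t,\oplus c_t\big)$ is ČF-regular if and only if each $(X_t,c_t)$ is ČF-regular.
   Context: $I=[0,1]$; a fuzzy (sub)set of a non-empty set $X$ is a map $f:X\to I$, and $I^X$ is the set of all of them, ordered pointwise, with $\vee,\wedge$ pointwise supremum/infimum. $\underline 0$ is the constant $0$ fuzzy set (the empty fuzzy set); $1_A$ is the characteristic function of $A\subseteq X$; the complement is $\mathfrak{Co}(f)(x)=1-f(x)$. For $x\in X$ and $0<\lambda\le1$, the fuzzy point $x_\lambda$ has value $\lambda$ at $x$ and $0$ elsewhere; $x_\lambda\in f$ means $x_\lambda\le f$, i.e. $\lambda\le f(x)$. A fuzzy closure space is a pair $(X,c)$ with $X$ a non-empty set and $c:I^X\to I^X$ satisfying $c(\underline 0)=\underline 0$, $f\le c(f)$, and $c(f\vee g)=c(f)\vee c(g)$ for all $f,g\in I^X$ (idempotency is not required). Sum: if the sets $X_t$ are pairwise disjoint, $X=\bigcup_{t\in T}X_t$ and $\oplus c_t(f)=\bigvee_{t\in T}c_t(1_{X_t}\wedge f)$ for $f\in I^X$, where $1_{X_t}\wedge f$ is regarded as a fuzzy subset of $X_t$ and $c_t(\cdot)\in I^{X_t}$ is extended by $0$ to $X$. The interior is $\operatorname{int}(f)=\mathfrak{Co}(c(\mathfrak{Co}(f)))$; $f$ is a neighborhood of a fuzzy set $k$ (in particular of a fuzzy point) if $k\le\operatorname{int}(f)$. $(X,c)$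 is ČF-regular if for each fuzzy point $x_\lambda$ and each non-empty fuzzy set $k$ in $X$ with $x_\lambda\in\mathfrak{Co}(c(k))$ there are neighborhoods $f$ of $x_\lambda$ and $g$ of $k$ with $f\le\mathfrak{Co}(g)$. *)

(* Defs.v *)
From mathcomp Require Import all_boot all_order all_algebra.
From mathcomp Require Import interval_inference.
From mathcomp Require Import boolp classical_sets reals.

Set Implicit Arguments.
Unset Strict Implicit.
Unset Printing Implicit Defensive.

Import Order.TTheory GRing.Theory Num.Theory.
Local Open Scope classical_set_scope.
Local Open Scope ring_scope.

Definition fuzzy (R : realType) (X : Type) : Type := X -> {i01 R}.

Section FuzzySets.
Context {R : realType}.

Section OneSet.
Context {X : Type}.
Implicit Types f g k : fuzzy R X.

Definition fle f g : Prop := forall x, f x <= g x.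

Definition fmax f g : fuzzy R X := fun x => Order.max (f x) (g x).

Definition fmin f g : fuzzy R X := fun x => Order.min (f x) (g x).

(* Least upper bound in I^X, taken pointwise in [0,1]; the supremum of the
   empty set is 0, the bottom of [0,1]. *)
Definition fsup {T : Type} (F : T -> fuzzy R X) : fuzzy R X :=
  fun x => supremum (0%:i01 : {i01 R}) (range (fun t => F t x)).

Definition fempty : fuzzy R X := fun=> 0%:i01.

Definition fchar (A : set X) : fuzzy R X :=
  fun x => if x \in A then 1%:i01 else 0%:i01.

Definition fcompl f : fuzzy R X := fun x => (1 - (f x)%:num)%:i01.

Definition fpoint (x : X) (l : {i01 R}) : fuzzy R X :=
  fun y => if `[< y = x >] then l else 0%:i01.

Record is_fuzzy_closure (c : fuzzy R X -> fuzzy R X) : Prop := {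
  fc_nonempty : inhabited X;
  fc_empty : c fempty = fempty;
  fc_ext : forall f, fle f (c f);
  fc_max : forall f g, c (fmax f g) = fmax (c f) (c g) }.

Definition fint (c : fuzzy R X -> fuzzy R X) f : fuzzy R X :=
  fcompl (c (fcompl f)).

Definition fnbhd (c : fuzzy R X -> fuzzy R X) (k f : fuzzy R X) : Prop :=
  fle k (fint c f).

Definition CF_regular (c : fuzzy R X -> fuzzy R X) : Prop :=
  forall (x : X) (l : {i01 R}) (k : fuzzy R X),
    0 < l%:num -> k <> fempty -> fle (fpoint x l) (fcompl (c k)) ->
    exists f g, [/\ fnbhd c (fpoint x l) f, fnbhd c k g & fle f (fcompl g)].

End OneSet.

(* A fuzzy subset of A regarded as a fuzzy subset of B: same values on the
   points of B lying in A, and 0 on the other points of B. It is the extension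
   by 0 when A `<=` B, and the restriction when B `<=` A. *)
Definition fregard {U : Type} (A B : set U) (f : fuzzy R A) : fuzzy R B :=
  fun y => oapp f 0%:i01 (insub (val y)).
Arguments fregard {U A} B f.

Definition fsum {U T : Type} (X_ : T -> set U)
    (c : forall t, fuzzy R (X_ t) -> fuzzy R (X_ t)) :
    fuzzy R (\bigcup_t X_ t) -> fuzzy R (\bigcup_t X_ t) :=
  fun f => fsup (fun t =>
    fregard _ (c t (fregard (X_ t) (fmin (fchar [set x | X_ t (val x)]) f)))).

End FuzzySets.
Arguments fregard {R U A} B f.

Section SumIsClosure.
Context {R : realType} {U T : Type} (X_ : T -> set U).
Context (c : forall t, fuzzy R (X_ t) -> fuzzy R (X_ t)).
Context (cP : forall t, is_fuzzy_closure (@c t)).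
Context (disj : trivIset setT X_).
Local Notation X := (\bigcup_t X_ t).

Lemma i01_ge0 (a : {i01 R}) : 0%:i01 <= a.
Proof. by rewrite -num_le /= ge0. Qed.

Lemma fregardE (A B : set U) (f : fuzzy R A) (y : B) (h : val y \in A) :
  fregard B f y = f (exist _ (val y) h).
Proof.
rewrite /fregard; case: insubP => [u _ uE|]; last by rewrite h.
by congr f; apply: val_inj; rewrite uE.
Qed.

Lemma fregard_out (A B : set U) (f : fuzzy R A) (y : B) :
  val y \notin A -> fregard B f y = 0%:i01.
Proof. by move=> h; rewrite /fregard insubN. Qed.

Lemma fsumE (t : T) (f : fuzzy R X) (y : X) (h : val y \in X_ t) :
  fsum c f y = c (fregard (X_ t) f) (exist _ (val y) h).
Proof.
rewrite /fsum /fsup.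
have cutE s : fregard (X_ s) (fmin (fchar [set x : X | X_ s (val x)]) f) =
             fregard (X_ s) f.
  apply/funext => z.
  have hz : val z \in X by apply/mem_set; exists s => //; exact/set_mem/valP.
  rewrite !fregardE /fmin /fchar mem_set /=; last exact/set_mem/valP.
  by apply/min_idPr; rewrite -num_le /= le1.
set F := fun s : T => _.
have Ft : F t = c (fregard (X_ t) f) (exist _ (val y) h).
  by rewrite /F cutE fregardE.
have Fs s : F s <= F t.
  case: (pselect (s = t)) => [->//|st].
  rewrite [F s]fregard_out; first exact: i01_ge0.
  apply/negP => hs; apply: st; apply: disj => //.
  by exists (val y); split; exact: set_mem.
have SF : supremums (range F) (F t).
  split=> [_ [s _ <-]|z]; first exact: Fs.
  by apply; exists t.
rewrite -Ft /supremum ifF; last by apply/negbTE/set0P; exists (F t), t.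
exact: (is_subset1_supremums (xgetPex _ (ex_intro _ _ SF)) SF).
Qed.

Lemma fsum_is_fuzzy_closure : inhabited T -> is_fuzzy_closure (fsum c).
Proof.
have ex (y : X) : exists t, val y \in X_ t.
  have [t _ Xy] : X (val y) by exact/set_mem/valP.
  by exists t; exact: mem_set.
have hX t (z : X_ t) : val z \in X.
  by apply/mem_set; exists t => //; exact/set_mem/valP.
have sv (A : set U) (z : A) h : exist _ (val z) h = z :> A by exact: val_inj.
case=> t0; split.
- have [x] := fc_nonempty (cP t0).
  by constructor; exact: (exist _ (val x) (hX _ x)).
- apply/funext => y; have [t h] := ex y; rewrite (fsumE _ h).
  rewrite (_ : fregard _ _ = fempty) ?(fc_empty (cP t))//.
  by apply/funext => z; rewrite fregardE.
- move=> f y; have [t h] := ex y; rewrite (fsumE _ h).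
  apply: le_trans (fc_ext (cP t) _ _).
  by rewrite fregardE ?valP// sv.
- move=> f g; apply/funext => y; have [t h] := ex y.
  rewrite [RHS]/fmax !(fsumE _ h).
  rewrite (_ : fregard _ (fmax f g) =
               fmax (fregard (X_ t) f) (fregard (X_ t) g)) ?(fc_max (cP t))//.
  by apply/funext => z; rewrite /fmax !fregardE.
Qed.

End SumIsClosure.

(* Main.v *)
(** Closure, interior, order and fuzzy points in the sum can all be read off
    on each summand separately, so regularity of the sum restricts to every
    summand.  Conversely, given a point of [X_t] and a fuzzy set [k], separate
    the point from the restriction of [k] to [X_t], then extend the
    neighborhood of the point by 0 and that of [k] by 1: outside [X_t] the
    latter has interior 1 because every closure fixes the empty fuzzy set. *)
Require Import Defs.
From mathcomp Require Import all_boot all_order all_algebra.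
From mathcomp Require Import interval_inference.
From mathcomp Require Import boolp classical_sets reals.

Local Open Scope classical_set_scope.
Local Open Scope ring_scope.

Import Order.TTheory GRing.Theory Num.Theory.

Section FuzzySetFacts.
Context {R : realType} {X : Type}.
Implicit Types f g : fuzzy R X.

Lemma fcomplK f : fcompl (fcompl f) = f.
Proof. by apply/funext => x; apply: val_inj; rewrite /= subKr. Qed.

Lemma fcompl_fempty (x : X) : fcompl fempty x = 1%:i01 :> {i01 R}.
Proof. by apply: val_inj; rewrite /= subr0. Qed.

Lemma i01_le1 (a : {i01 R}) : a <= 1%:i01.
Proof. by rewrite -num_le /= le1. Qed.

Lemma fpoint_le (x : X) (l : {i01 R}) f : fle (fpoint x l) f <-> l <= f x.
Proof.
split=> [/(_ x)|lf y]; rewrite /fpoint; first by rewrite asboolT.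
by case: asboolP => [->//|_]; exact: i01_ge0.
Qed.

(** Extends regularity to an empty [k], because a non-empty fuzzy set of the sum may restrict to the
    empty one on a summand. In that case the constants 1 and 0 separate, the constant 1 being its
    own interior. *)
Lemma CF_regular_separates (c : fuzzy R X -> fuzzy R X) (x : X) (l : {i01 R})
    (k : fuzzy R X) :
  is_fuzzy_closure c -> CF_regular c -> 0 < l%:num -> l <= fcompl (c k) x ->
  exists f g, [/\ fnbhd c (fpoint x l) f, fnbhd c k g & fle f (fcompl g)].
Proof.
move=> cP reg l0 lk; have [->|k0] := pselect (k = fempty); last first.
  by apply: reg => //; exact/fpoint_le.
exists (fcompl fempty), fempty; split=> // [|y]; last exact: i01_ge0.
apply/fpoint_le.
by rewrite /fint fcomplK (fc_empty cP) fcompl_fempty i01_le1.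
Qed.

End FuzzySetFacts.

Section Sum.
Context {R : realType} {U T : Type} {X_ : T -> set U}.
Context {c : forall t, fuzzy R (X_ t) -> fuzzy R (X_ t)}.
Context (disj : trivIset setT X_).
Local Notation X := (\bigcup_t X_ t).

Lemma sum_inj_subproof {t : T} (z : X_ t) : val z \in X.
Proof. by apply/mem_set; exists t => //; exact/set_mem/valP. Qed.

(** [X_ t] and [X] are distinct subtypes of [U], so the inclusion has to be an explicit map. *)
Definition sum_inj {t : T} (z : X_ t) : X :=
  exist (fun x => x \in X) (val z) (sum_inj_subproof z).

Lemma sum_injP (y : X) : exists t (z : X_ t), y = sum_inj z.
Proof.
have [t _ Xy] : X (val y) by exact/set_mem/valP.
by exists t, (exist (fun x => x \in X_ t) (val y) (mem_set Xy)); exact: val_inj.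
Qed.

Lemma fregard_restrE {t : T} (f : fuzzy R X) (z : X_ t) :
  fregard (X_ t) f z = f (sum_inj z).
Proof.
by rewrite (fregardE f (sum_inj_subproof z)); congr f; exact: val_inj.
Qed.

Lemma fregard_extE {t : T} (f : fuzzy R (X_ t)) (z : X_ t) :
  fregard X f (sum_inj z) = f z.
Proof.
by rewrite (fregardE f (y := sum_inj z) (valP z)); congr f; exact: val_inj.
Qed.

Lemma fregard_ext0 {s t : T} (f : fuzzy R (X_ t)) (z : X_ s) :
  s <> t -> fregard X f (sum_inj z) = 0%:i01.
Proof.
move=> st; apply: fregard_out; apply/negP => zt; apply: st; apply: disj => //.
by exists (val z); split; [exact/set_mem/valP|exact: set_mem].
Qed.

Lemma fregard_extK {t : T} (f : fuzzy R (X_ t)) :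
  fregard (X_ t) (fregard X f) = f.
Proof. by apply/funext => z; rewrite fregard_restrE fregard_extE. Qed.

Lemma fregard_restr_compl {t : T} (f : fuzzy R X) :
  fregard (X_ t) (fcompl f) = fcompl (fregard (X_ t) f).
Proof. by apply/funext => z; rewrite /fcompl !fregard_restrE. Qed.

Lemma fregard_ext_other {s t : T} (f : fuzzy R (X_ t)) :
  s <> t -> fregard (X_ s) (fregard X f) = fempty.
Proof. by move=> st; apply/funext => z; rewrite fregard_restrE fregard_ext0. Qed.

(** By disjointness, only the term of index [t] in the supremum can be nonzero at a point of
    [X_ t]. *)
Lemma fsum_injE {t : T} (f : fuzzy R X) (z : X_ t) :
  fsum c f (sum_inj z) = c t (fregard (X_ t) f) z.
Proof.
rewrite (fsumE c disj f (y := sum_inj z) (valP z)).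
by congr (c t _ _); exact: val_inj.
Qed.

Lemma fint_injE {t : T} (f : fuzzy R X) (z : X_ t) :
  fint (fsum c) f (sum_inj z) = fint (c t) (fregard (X_ t) f) z.
Proof. by rewrite /fint /fcompl fsum_injE fregard_restr_compl. Qed.

Lemma CF_regular_summand (t : T) : CF_regular (fsum c) -> CF_regular (c t).
Proof.
move=> reg x l k l0 k0 /fpoint_le lk.
have [||f [g [/fpoint_le xf kg fg]]] := reg (sum_inj x) l (fregard X k) l0.
(* Restricting the extension of [k] gives back [k], so the extension is non-empty too. *)
- move=> K0; apply: k0; rewrite -(fregard_extK k) K0.
  by apply/funext => z; rewrite fregard_restrE.
- by apply/fpoint_le; rewrite /fcompl fsum_injE fregard_extK.
exists (fregard (X_ t) f), (fregard (X_ t) g); split.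
- by apply/fpoint_le; rewrite -fint_injE.
- by move=> z; rewrite -fint_injE -(fregard_extE k); exact: kg.
- by move=> z; rewrite -fregard_restr_compl !fregard_restrE; exact: fg.
Qed.

Lemma CF_regular_sum (cP : forall t, is_fuzzy_closure (c t)) :
  (forall t, CF_regular (c t)) -> CF_regular (fsum c).
Proof.
move=> reg y l k l0 _ /fpoint_le; have [t [x ->]] := sum_injP y => lk.
have [|f [g [/fpoint_le xf kg fg]]] :=
    CF_regular_separates (c t) x l (fregard (X_ t) k) (cP t) (reg t) l0.
  by move: lk; rewrite /fcompl fsum_injE.
(* Complementing before and after the extension by 0 yields the extension of [g] by 1. *)
exists (fregard X f), (fcompl (fregard X (fcompl g))); split.
- by apply/fpoint_le; rewrite fint_injE fregard_extK.
- move=> y'; have [s [z ->]] := sum_injP y'; rewrite fint_injE.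
  have [st|st] := pselect (s = t).
    (* The type of [z] depends on [s], so [z] is generalized while [s] is replaced by [t]. *)
    case: _ / (esym st) z => z.
    rewrite fregard_restr_compl fregard_extK fcomplK -fregard_restrE.
    exact: kg.
  rewrite fregard_restr_compl (fregard_ext_other _ st) /fint fcomplK.
  by rewrite (fc_empty (cP s)) fcompl_fempty i01_le1.
- move=> y'; have [s [z ->]] := sum_injP y'; rewrite fcomplK.
  (* Outside [X_ t] both sides of the inequality are 0. *)
  have [st|st] := pselect (s = t); last by rewrite !(fregard_ext0 _ _ st).
  by case: _ / (esym st) z => z; rewrite !fregard_extE; exact: fg.
Qed.

End Sum.

Theorem theorem7p3 (R : realType) (U T : Type) (X_ : T -> set U)
    (c : forall t, fuzzy R (X_ t) -> fuzzy R (X_ t))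
    (closure_c : forall t, is_fuzzy_closure (c t))
    (disjoint_X : trivIset setT X_) :
  CF_regular (fsum c) <-> forall t, CF_regular (c t).
Proof.
split=> [reg t|]; first exact: (CF_regular_summand disjoint_X).
exact: CF_regular_sum.
Qed.
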